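(* Let $\mathcal H,\mathcal K$ be real or complex Hilbert spaces. If $T:\mathcal H\to\mathcal K$ is a densely defined linear operator (not assumed closable), then $T^*T$ has a positive self-adjoint extension.
   Context: A linear operator $T:\mathcal H\to\mathcal K$ is a linear map from a linear subspace $\operatorname{dom}T\subseteq\mathcal H$ into $\mathcal K$. For densely defined $T$, $T^*:\mathcal K\to\mathcal H$ is the adjoint, whose domain need not be dense. The operator $T^*T$ has domain $\operatorname{dom}(T^*T)=\{f\in\operatorname{dom}T: Tf\in\operatorname{dom}T^*\}$, which need not be dense in $\mathcal H$. An operator $S$ in $\mathcal H$ is self-adjoint if it is densely defined and $S^*=S$; it is positive if it is symmetric and $\langle Sf,f\rangle\ge0$ for all $f\in\operatorname{dom}S$. *)

(* Defs.v *)
From HB Require Import structures.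
From mathcomp Require Import all_boot all_order all_algebra sesquilinear.
From mathcomp Require Import all_classical reals topology normedtype.
From mathcomp Require Import complex.

Set Implicit Arguments.
Unset Strict Implicit.
Unset Printing Implicit Defensive.

Import Order.TTheory GRing.Theory Num.Theory Num.Def.
Import numFieldNormedType.Exports.

Local Open Scope classical_set_scope.
Local Open Scope ring_scope.

(* The inner product is linear in its first argument and theta-semilinear in
   its second one. *)
Record hilbertType (F : numFieldType) (theta : {rmorphism F -> F}) := Hilbert {
  hilbert_sort :> completeNormedModType F ;
  inner : {dot hilbert_sort for theta} ;
  inner_norm : forall x : hilbert_sort, inner x x = `|x| ^+ 2 }.

Notation "''[' u , v ]" := (inner _ u v)
  (format "''[' u ,  v ]") : ring_scope.

Definition real_conj (R : realType) : {rmorphism R -> R} := idfun.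
Notation realHilbertType R := (hilbertType (real_conj R)).

Definition complex_conj (R : realType) : {rmorphism R[i] -> R[i]} := conjC.
Notation complexHilbertType R := (hilbertType (complex_conj R)).

(* The values of op_fun outside op_dom are irrelevant: operators are only
   compared through extends and same_operator. *)
Record operator (F : numFieldType) (V W : lmodType F) := Operator {
  op_dom : set V ;
  op_fun :> V -> W ;
  op_dom0 : op_dom 0 ;
  op_domP : forall (a : F) x y, op_dom x -> op_dom y -> op_dom (a *: x + y) ;
  op_linear : forall (a : F) x y, op_dom x -> op_dom y ->
    op_fun (a *: x + y) = a *: op_fun x + op_fun y }.

Section Operators.
Variables (F : numFieldType).

Definition extends (V W : lmodType F) (S T : operator V W) :=
  op_dom T `<=` op_dom S /\ forall x, op_dom T x -> S x = T x.

Definition same_operator (V W : lmodType F) (S T : operator V W) :=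
  extends S T /\ extends T S.

Section Composition.
Variables (U V W : lmodType F) (S : operator V W) (T : operator U V).

Definition comp_dom : set U := op_dom T `&` T @^-1` op_dom S.

Fact comp_dom0 : comp_dom 0.
Proof.
split; first exact: op_dom0.
have T0 : T 0 = 0.
  have := op_linear (-1) (op_dom0 T) (op_dom0 T).
  by rewrite !scaler0 addr0 scaleN1r addNr.
by rewrite /= T0; exact: op_dom0.
Qed.

Fact comp_domP (a : F) x y : comp_dom x -> comp_dom y -> comp_dom (a *: x + y).
Proof.
move=> [Tx STx] [Ty STy]; split; first exact: op_domP.
by rewrite /= op_linear//; exact: op_domP.
Qed.

Fact comp_linear (a : F) x y : comp_dom x -> comp_dom y ->
  S (T (a *: x + y)) = a *: S (T x) + S (T y).
Proof. by move=> [Tx STx] [Ty STy]; rewrite !op_linear. Qed.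

Definition op_comp : operator U W :=
  @Operator F U W comp_dom (S \o T) comp_dom0 comp_domP comp_linear.

End Composition.

Section Adjoint.
Variable theta : {rmorphism F -> F}.

Definition densely_defined (H K : hilbertType theta) (T : operator H K) :=
  dense (op_dom T).

Variables (H K : hilbertType theta) (T : operator H K).
Hypothesis denseT : densely_defined T.

Definition adjoint_rel (g : K) : set H :=
  [set h | forall f, op_dom T f -> '[T f, g] = '[f, h] ].

Definition adjoint_dom : set K := [set g | adjoint_rel g !=set0].

Definition adjoint_fun (g : K) : H := xget 0 (adjoint_rel g).

Lemma dense_orthogonal_eq0 (h : H) :
  (forall f, op_dom T f -> '[f, h] = 0) -> h = 0.
Proof.
move=> Th; apply/eqP; apply: contraT => h0.
have nh : 0 < `|h| by rewrite normr_gt0.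
have [f [fh Tf]] := denseT (ex_intro _ h (ballxx h nh)) (ball_open h _).
have hf : '[h, f] = 0 by rewrite hermC/= Th// rmorph0 mulr0.
have : `|h| ^+ 2 <= `|h - f| ^+ 2.
  rewrite -!inner_norm linearBl/= !linearBr/= hf (Th f Tf) sub0r opprK subr0.
  by rewrite lerDl inner_norm exprn_ge0.
rewrite ler_pXn2r ?nnegrE// => hhf.
have : ball h `|h| f by exact: fh.
rewrite -ball_normE /= => /(le_lt_trans hhf).
by rewrite ltxx.
Qed.

Lemma adjoint_rel_inj g h h' : adjoint_rel g h -> adjoint_rel g h' -> h = h'.
Proof.
move=> gh gh'; apply/eqP; rewrite -subr_eq0; apply/eqP.
apply: dense_orthogonal_eq0 => f Tf.
by rewrite linearBr/= -gh// -gh'// subrr.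
Qed.

Lemma adjoint_relP (a : F) g g' h h' : adjoint_rel g h -> adjoint_rel g' h' ->
  adjoint_rel (a *: g + g') (a *: h + h').
Proof.
move=> gh gh' f Tf.
by rewrite !linearDr/= !linearZr_LR/= gh// gh'.
Qed.

Lemma adjoint_funP g : adjoint_dom g -> adjoint_rel g (adjoint_fun g).
Proof. by move=> [h gh]; exact: (xgetI 0 gh). Qed.

Fact adjoint_dom0 : adjoint_dom 0.
Proof. by exists 0 => f _; rewrite !linear0r. Qed.

Fact adjoint_domP (a : F) g g' : adjoint_dom g -> adjoint_dom g' ->
  adjoint_dom (a *: g + g').
Proof. by move=> [h gh] [h' gh']; exists (a *: h + h'); exact: adjoint_relP. Qed.

Fact adjoint_linear (a : F) g g' : adjoint_dom g -> adjoint_dom g' ->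
  adjoint_fun (a *: g + g') = a *: adjoint_fun g + adjoint_fun g'.
Proof.
move=> dg dg'; apply: (@adjoint_rel_inj (a *: g + g')).
  by apply: adjoint_funP; exact: adjoint_domP.
by apply: adjoint_relP; exact: adjoint_funP.
Qed.

Definition adjoint : operator K H :=
  @Operator F K H adjoint_dom adjoint_fun
    adjoint_dom0 adjoint_domP adjoint_linear.

End Adjoint.

Section Selfadjoint.
Variables (theta : {rmorphism F -> F}) (H : hilbertType theta).

Definition self_adjoint (S : operator H H) :=
  exists denseS : densely_defined S, same_operator (adjoint denseS) S.

Definition symmetric_operator (S : operator H H) :=
  forall f g, op_dom S f -> op_dom S g -> '[S f, g] = '[f, S g].

(* Over the complex numbers 0 <= z means that z is real and nonnegative. *)
Definition positive_operator (S : operator H H) :=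
  symmetric_operator S /\ forall f, op_dom S f -> 0 <= '[S f, f].

End Selfadjoint.

End Operators.

(* Main.v *)
(** Let A = T^*T and let D be its domain. The assignment T f |-> A f, for f in D,
    is densely defined in the closure E of T(D); its adjoint L : H -> E is closed,
    extends P_E T (so it is densely defined) and satisfies L f = T f and
    L^* (T f) = A f for f in D. Hence S = L^* L extends A, and it is self-adjoint by
    von Neumann's argument: projecting (h, 0) onto the graph of L solves
    f + S f = h, and a positive operator S with I + S onto is self-adjoint.

    The real and the complex case are treated at once, over a numFieldType in
    which sets of nonnegative elements have infima. *)
Require Import Defs.
From HB Require Import structures.
From mathcomp Require Import all_boot all_order all_algebra sesquilinear.
From mathcomp Require Import all_classical reals topology normedtype complex.
From mathcomp Require Import ring.

Set Implicit Arguments.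
Unset Strict Implicit.
Unset Printing Implicit Defensive.

Import Order.TTheory GRing.Theory Num.Theory Num.Def.
Import numFieldNormedType.Exports.

Local Open Scope classical_set_scope.
Local Open Scope ring_scope.

Definition linear_set (F : numFieldType) (V : lmodType F) (M : set V) :=
  M 0 /\ forall (a : F) x y, M x -> M y -> M (a *: x + y).

(* Satisfied by R and by R[i], whose nonnegative elements are real. *)
Definition has_infima (F : numFieldType) :=
  forall A : set F, A !=set0 -> (forall x, A x -> 0 <= x) ->
    exists m, (forall x, A x -> m <= x) /\
      forall e, 0 < e -> exists2 x, A x & x < m + e.

(** The witness, product over sum, is below both numbers without comparing them with each other. *)
Lemma lower_bound2 (F : numFieldType) (e1 e2 : F) : 0 < e1 -> 0 < e2 ->
  exists2 e, 0 < e & e <= e1 /\ e <= e2.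
Proof.
move=> e1_gt0 e2_gt0; have e12 : 0 < e1 + e2 by rewrite addr_gt0.
exists (e1 * e2 / (e1 + e2)); first by rewrite divr_gt0 ?mulr_gt0.
rewrite !ler_pdivrMr//; split.
  by rewrite ler_pM2l// lerDr ltW.
by rewrite [e1 * e2]mulrC ler_pM2l// lerDl ltW.
Qed.

(** * Dot products: Cauchy-Schwarz, closure and orthogonal projection *)

Section Dot.
Variables (F : numFieldType) (theta : {rmorphism F -> F}) (V : lmodType F).
Variable b : {dot V for theta}.

Lemma dotZl a u v : b (a *: u) v = a * b u v.
Proof. exact: (linearZl_LR b). Qed.

Lemma dotZr a u v : b u (a *: v) = theta a * b u v.
Proof. exact: (linearZr_LR b). Qed.

Lemma dotC u v : b u v = theta (b v u).
Proof. by rewrite hermC expr0 mul1r. Qed.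

Lemma dot_ge0 u : 0 <= b u u.
Proof.
have [->|u0] := eqVneq u 0; first by rewrite (linear0l b).
exact/ltW/neq0_dnorm_gt0.
Qed.

Lemma dot_eq0 u : b u u = 0 -> u = 0.
Proof.
move=> bu; apply/eqP; apply: contraT => u0.
by have := @neq0_dnorm_gt0 _ _ _ b u u0; rewrite bu ltxx.
Qed.

Lemma conj_dot u : theta (b u u) = b u u.
Proof. by rewrite -dotC. Qed.

(** [c * theta c] stands for |c|^2. Since [theta] is an arbitrary ring morphism, its sign is read
    off from [b] at [c *: w], whence the nonzero vector. *)
Lemma sqnorm_ge0 (w : V) c : w != 0 -> 0 <= c * theta c.
Proof.
move=> w0; have := dot_ge0 (c *: w); rewrite dotZl dotZr/= mulrA.
by rewrite pmulr_lge0// neq0_dnorm_gt0.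
Qed.

(** The right side minus the left is |c - d|^2. *)
Lemma sqnorm_addr (w : V) c d : w != 0 ->
  (c + d) * theta (c + d) <= (c * theta c + d * theta d) *+ 2.
Proof.
move=> w0; rewrite -subr_ge0; apply: le_trans (sqnorm_ge0 (c - d) w0) _.
by rewrite le_eqVlt; apply/orP; left; apply/eqP; rewrite rmorphB rmorphD; ring.
Qed.

Lemma dot_proj u w : w != 0 ->
  b (u - (b u w / b w w) *: w) (u - (b u w / b w w) *: w) =
  b u u - b u w * theta (b u w) / b w w.
Proof.
move=> w0; have bw0 : b w w != 0.
  by rewrite gt_eqF// neq0_dnorm_gt0.
rewrite linearBl/= !linearBr/= !dotZl !dotZr/= (dotC w u).
rewrite fmorph_div/= conj_dot; field.
exact: bw0.
Qed.

Lemma dot_Cauchy_Schwarz u w :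
  b u w * theta (b u w) <= b u u * b w w.
Proof.
have [->|w0] := eqVneq w 0; first by rewrite !(linear0r b) mul0r mulr0.
have := dot_ge0 (u - (b u w / b w w) *: w); rewrite dot_proj// subr_ge0.
by rewrite ler_pdivrMr// neq0_dnorm_gt0.
Qed.

Lemma dot_parallelogram u v :
  b (u - v) (u - v) = (b u u + b v v) *+ 2 - b (u + v) (u + v).
Proof. by rewrite !linearBl/= !linearBr/= !linearDl/= !linearDr/=; ring. Qed.

Lemma dotBC u v : b (u - v) (u - v) = b (v - u) (v - u).
Proof. by rewrite -hnormN opprB. Qed.

Lemma sqnorm_small (w : V) c k : w != 0 -> 0 <= k ->
  (forall e, 0 < e -> c * theta c <= e * k) -> c = 0.
Proof.
move=> w0 k0 ck; suff: c * theta c = 0.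
  by move=> /eqP; rewrite mulf_eq0 fmorph_eq0 orbb => /eqP.
apply/eqP; rewrite eq_le (sqnorm_ge0 _ w0) andbT.
apply/ler_addgt0Pr => e e0; rewrite add0r.
have k1 : 0 < k + 1 by rewrite ltr_wpDl.
apply: (le_trans (ck (e / (k + 1)) _)); first by rewrite divr_gt0.
rewrite mulrAC ler_pdivrMr// ler_pM2l//.
by rewrite lerDl.
Qed.

(** Phrased through [b] alone, with no norm or topology, so that it also applies to
    [product_dot]. *)
Definition dot_closure (M : set V) : set V :=
  [set p | forall e, 0 < e -> exists2 r, M r & b (r - p) (r - p) < e].

Lemma dot_closure_orthogonal (M : set V) p q :
  (forall r, M r -> b r q = 0) -> dot_closure M p -> b p q = 0.
Proof.
move=> Mq Mp; have [->|q0] := eqVneq q 0; first exact: (linear0r b).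
apply: (sqnorm_small q0 (dot_ge0 q)) => e e0; have [r Mr re] := Mp e e0.
have -> : b p q = b (p - r) q by rewrite linearBl/= (Mq r Mr) subr0.
apply: (le_trans (dot_Cauchy_Schwarz _ _)).
by rewrite ler_wpM2r ?dot_ge0// dotBC ltW.
Qed.

(* Completeness for the distance induced by b, with Cauchy nets of shrinking
   sets in place of Cauchy sequences: F need not be archimedean. *)
Definition dot_complete := forall M : F -> set V,
  (forall e, 0 < e -> M e !=set0) ->
  (forall e e', e <= e' -> M e `<=` M e') ->
  (forall e, 0 < e -> forall x y, M e x -> M e y ->
    b (x - y) (x - y) <= e *+ 4) ->
  exists x0, forall e, 0 < e -> exists2 d, 0 < d &
    forall x, M d x -> b (x - x0) (x - x0) < e.

(** Near-minimizers of the distance from [z] to [M] form a Cauchy net by the parallelogram law; [p]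
    is its limit. A near-minimizer [r] makes [z - r] almost orthogonal to [M], and this passes to
    the limit. *)
Lemma orthogonal_projection (M : set V) z :
  has_infima F -> dot_complete -> linear_set M ->
  exists2 p, dot_closure M p & forall w, M w -> b (z - p) w = 0.
Proof.
move=> infF bC [M0 Ml].
have [||m [mle mad]] := infF [set b (z - r) (z - r) | r in M].
- by exists (b (z - 0) (z - 0)), 0.
- by move=> _ [r _ <-]; exact: dot_ge0.
pose N e := [set r | M r /\ b (z - r) (z - r) < m + e].
have N_neq0 e : 0 < e -> N e !=set0.
  by move=> /mad[_ [r Mr <-] rm]; exists r.
have N_mono e e' : e <= e' -> N e `<=` N e'.
  by move=> ee' r [Mr rm]; split=> //; apply: (lt_le_trans rm); rewrite lerD2l.
have [|p Np] := bC N N_neq0 N_mono.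
  move=> e e0 x y [Mx xm] [My ym].
  have -> : x - y = (z - y) - (z - x) by rewrite opprB [RHS]addrC subrKA.
  rewrite dot_parallelogram.
  (* The midpoint of [x] and [y] lies in [M], so its squared distance to [z] is at least [m]. The
     [+ 0] fits the shape [a *: x + y] of [linear_set]. *)
  have -> : (z - y) + (z - x) = 2 *: (z - (2^-1 *: x + (2^-1 *: y + 0))).
    rewrite addr0 scalerBr scalerDr !scalerA divff ?pnatr_eq0// !scale1r.
    by rewrite scaler_nat mulr2n opprD addrACA [- y - x]addrC.
  pose r := 2^-1 *: x + (2^-1 *: y + 0); rewrite -/r; have Mr : M r by apply: (Ml) => //; exact: Ml.
  have mr : m <= b (z - r) (z - r) by apply: mle; exists r.
  rewrite dotZl dotZr/= rmorph_nat lerBlDr.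
  have -> : e *+ 4 + 2 * (2 * b (z - r) (z - r)) =
            (e + b (z - r) (z - r) + (e + b (z - r) (z - r))) *+ 2 by ring.
  rewrite ler_pMn2r//; apply: lerD; rewrite [e + _]addrC ltW//.
    by apply: (lt_le_trans ym); rewrite lerD2r.
  by apply: (lt_le_trans xm); rewrite lerD2r.
exists p.
  move=> e e0; have [d d0 dN] := Np e e0.
  by have [r Nr] := N_neq0 d d0; exists r; [case: Nr|exact: dN].
move=> w Mw; have [->|w0] := eqVneq w 0; first exact: (linear0r b).
have bw : 0 < b w w by rewrite neq0_dnorm_gt0.
(* The 4 is the 2 of [sqnorm_addr] times two errors of at most [e * b w w], one from [z - r] and one
   from [r - p]. *)
apply: (@sqnorm_small w _ (b w w *+ 4)) => //; first by rewrite mulrn_wge0 ?ltW.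
move=> e e0; have [d d0 dN] := Np e e0.
have [d' d'0 [d'd d'e]] := lower_bound2 d0 e0.
have [r Nr] := N_neq0 d' d'0; have [Mr rm] := N_mono _ _ d'e r Nr.
have rp : b (r - p) (r - p) < e by exact/dN/(N_mono _ _ d'd).
(* Adding the best multiple of [w] to [r] lowers the squared distance by |c|^2 / [b w w], which
   cannot exceed [e] because [r] is within [e] of the infimum. *)
have zr : b (z - r) w * theta (b (z - r) w) <= e * b w w.
  rewrite -ler_pdivrMr//; set c := b (z - r) w.
  have : m <= b (z - r) (z - r) - c * theta c / b w w.
    rewrite -dot_proj//; apply: mle; exists ((c / b w w) *: w + r).
      exact: Ml.
    by congr (b _ _); rewrite opprD addrCA addrC.
  rewrite lerBrDl => /le_lt_trans /(_ rm).
  by rewrite [m + e]addrC ltrD2r => /ltW.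
have -> : z - p = (z - r) + (r - p) by rewrite addrA subrK.
rewrite linearDl/=; apply: (le_trans (sqnorm_addr _ _ w0)).
rewrite [_ *+ 4](mulrnA _ 2 2) mulrnAr lerMn2r/= mulr2n mulrDr.
apply: lerD => //; apply: (le_trans (dot_Cauchy_Schwarz _ _)).
by rewrite ler_pM2r// ltW.
Qed.

End Dot.

(** * The orthogonal direct sum of two inner product spaces *)

Section ProductDot.
Variables (F : numFieldType) (theta : {rmorphism F -> F}) (V W : lmodType F).
Variables (b : {dot V for theta}) (c : {dot W for theta}).

Definition prod_dot (p q : V * W) : F := b p.1 q.1 + c p.2 q.2.

Lemma prod_dot_bilinear : bilinear_for *%R (theta \; *%R) prod_dot.
Proof.
split=> p a x y; rewrite /prod_dot/=.
  rewrite !linearDl/= !dotZl/=; ring.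
rewrite !linearDr/= !dotZr/=; ring.
Qed.

Lemma prod_dot_hermitian p q : prod_dot p q = (-1) ^+ false * theta (prod_dot q p).
Proof. by rewrite expr0 mul1r rmorphD/= -!dotC. Qed.

Lemma prod_dot_gt0 p : p != 0 -> 0 < prod_dot p p.
Proof.
move=> p0; rewrite lt_def addr_ge0 ?dot_ge0// andbT.
apply: contra p0; rewrite paddr_eq0 ?dot_ge0// => /andP[/eqP/dot_eq0 p1 /eqP/dot_eq0 p2].
by apply/eqP/pair_eqP; rewrite /= p1 p2 !eqxx.
Qed.

HB.instance Definition _ := bilinear_isBilinear.Build F (V * W)%type (V * W)%type F
  *%R (theta \; *%R) prod_dot prod_dot_bilinear.
HB.instance Definition _ := isHermitianSesquilinear.Build F (V * W)%type false theta
  prod_dot prod_dot_hermitian.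
HB.instance Definition _ := isDotProduct.Build F (V * W)%type prod_dot prod_dot_gt0.

Definition product_dot : {dot (V * W)%type for theta} := prod_dot.

Lemma product_dotE p q : product_dot p q = b p.1 q.1 + c p.2 q.2.
Proof. by []. Qed.

Lemma product_dot_complete :
  dot_complete b -> dot_complete c -> dot_complete product_dot.
Proof.
move=> bC cC M M_neq0 M_mono M_cauchy.
have [|||x0 Mx0] := bC (fun e => fst @` M e).
- by move=> e /M_neq0[p Mp]; exists p.1, p.
- by move=> e e' ee' _ [p Mp <-]; exists p => //; exact: M_mono Mp.
- move=> e e0 _ _ [p Mp <-] [q Mq <-]; apply: le_trans (M_cauchy e e0 p q Mp Mq).
  by rewrite lerDl dot_ge0.
have [|||y0 My0] := cC (fun e => snd @` M e).
- by move=> e /M_neq0[p Mp]; exists p.2, p.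
- by move=> e e' ee' _ [p Mp <-]; exists p => //; exact: M_mono Mp.
- move=> e e0 _ _ [p Mp <-] [q Mq <-]; apply: le_trans (M_cauchy e e0 p q Mp Mq).
  by rewrite lerDr dot_ge0.
exists (x0, y0) => e e0; have e2 : 0 < e / 2 by rewrite divr_gt0.
have [d1 d10 Md1] := Mx0 _ e2; have [d2 d20 Md2] := My0 _ e2.
have [d d0 [dd1 dd2]] := lower_bound2 d10 d20.
exists d => // p Mp; rewrite [e]splitr; apply: ltrD.
  by apply: Md1; exists p => //; exact: M_mono Mp.
by apply: Md2; exists p => //; exact: M_mono Mp.
Qed.

End ProductDot.

(** * Completeness of Hilbert spaces; infima over the real and complex numbers *)

Lemma hilbert_complete (F : numFieldType) (theta : {rmorphism F -> F})
  (H : hilbertType theta) : dot_complete (@inner F theta H).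
Proof.
move=> M M_neq0 M_mono M_cauchy.
pose G := filter_from [set e : F | 0 < e] M.
have FG : Filter G.
  apply: filter_from_filter; first by exists 1 => /=.
  move=> e e' /= e0 e'0; have [d d0 [de de']] := lower_bound2 e0 e'0.
  by exists d => // x Mx; split; exact: M_mono Mx.
have PG : ProperFilter G by exact: filter_from_proper.
(* For radii at most 1, a bound on the norm also bounds its square, so no square root is taken in
   [F]. *)
have sqr_lt (x : H) e : 0 < e -> e <= 1 -> `|x| < e -> `|x| ^+ 2 < e.
  move=> e0 e1 xe; rewrite expr2; apply: (le_lt_trans _ xe).
  by rewrite ler_piMr// (le_trans _ e1)// ltW.
have Gcauchy : cauchy G.
  apply: cauchy_exP => e /= e0.
  (* [M_cauchy] yields four times this value, e^2 / 2, strictly below e^2. *)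
  have d0 : 0 < e ^+ 2 / 8 by rewrite divr_gt0 ?exprn_gt0.
  have [x Mx] := M_neq0 _ d0; exists x; exists (e ^+ 2 / 8) => // y My.
  rewrite -ball_normE /= -(ltr_pXn2r (n := 2))// ?nnegrE ?(ltW e0)//.
  rewrite -inner_norm; apply: (le_lt_trans (M_cauchy _ d0 _ _ Mx My)).
  have -> : e ^+ 2 / 8 *+ 4 = e ^+ 2 / 2 by field.
  by rewrite ltr_pdivrMr// ltr_pMr ?exprn_gt0// ltr1n.
have /cvg_ex[x0 Gx0] : cvg G by exact: cauchy_cvg.
exists x0 => e e0; have [d d0 [de d1]] := lower_bound2 e0 ltr01.
have [r r0 Mr] : G (ball x0 d) by apply: Gx0; exact: nbhsx_ballx.
exists r => // x /Mr; rewrite -ball_normE /= distrC => xd.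
by rewrite inner_norm; apply: lt_le_trans de; exact: sqr_lt.
Qed.

Lemma real_has_infima (R : realType) : has_infima R.
Proof.
move=> A A_neq0 A_ge0.
have lbA : has_lbound A by exists 0 => x /A_ge0.
exists (inf A); split=> [x|e e0]; first exact: ge_inf.
exact: inf_adherent.
Qed.

(** Nonnegative complex numbers are real, so the infimum is taken among real parts. *)
Lemma complex_has_infima (R : realType) : has_infima R[i].
Proof.
move=> A [z Az] A_ge0.
have real_of (w : R[i]) : 0 <= w -> w = (complex.Re w)%:C%C.
  by case: w => a b; rewrite lecE/= => /andP[/eqP-> _].
have [||m [mle mad]] := @real_has_infima R [set r | A r%:C%C].
- by exists (complex.Re z); rewrite /= -real_of//; exact: A_ge0.
- by move=> r /A_ge0; rewrite lecR.
exists m%:C%C; split=> [w Aw|e e0].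
  rewrite (real_of w (A_ge0 w Aw)) lecR; apply: mle.
  by rewrite /= -real_of//; exact: A_ge0.
have := e0; rewrite (real_of e (ltW e0)) ltcR => /mad[r Ar rm].
by exists r%:C%C => //; rewrite -rmorphD ltcR.
Qed.

(** Serves to build the extension from its graph: [xget] picks the unique value, with default 0
    outside the domain. *)
Lemma operator_of_rel (F : numFieldType) (V W : lmodType F)
    (r : V -> W -> Prop) :
  r 0 0 ->
  (forall (a : F) x y u v, r x u -> r y v -> r (a *: x + y) (a *: u + v)) ->
  (forall x u v, r x u -> r x v -> u = v) ->
  exists S : operator V W, forall x u, r x u <-> op_dom S x /\ S x = u.
Proof.
move=> r0 rl rinj.
pose d := [set x | exists u, r x u]; pose s x := xget 0 [set u | r x u].
have rs x : d x -> r x (s x) by move=> [u xu]; exact: (xgetI 0 xu).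
have d0 : d 0 by exists 0.
have dl (a : F) x y : d x -> d y -> d (a *: x + y).
  by move=> [u xu] [v yv]; exists (a *: u + v); exact: rl.
have sl (a : F) x y : d x -> d y -> s (a *: x + y) = a *: s x + s y.
  move=> dx dy; apply: rinj (rs _ (dl a _ _ dx dy)) _.
  by apply: rl; exact: rs.
exists (Operator d0 dl sl) => x u /=; split=> [xu|[dx <-]]; last exact: rs.
have dx : d x by exists u.
by split => //; exact: rinj (rs x dx) xu.
Qed.

Lemma op_dom_linear (F : numFieldType) (V W : lmodType F) (T : operator V W) :
  linear_set (op_dom T).
Proof. by split; [exact: op_dom0|exact: op_domP]. Qed.

Lemma op_fun0 (F : numFieldType) (V W : lmodType F) (T : operator V W) : T 0 = 0.
Proof.
have := op_linear (-1) (op_dom0 T) (op_dom0 T).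
by rewrite !scaler0 addr0 scaleN1r addNr.
Qed.

(** * Construction of the self-adjoint extension *)

Section SelfAdjointExtension.
Variables (F : numFieldType) (theta : {rmorphism F -> F}).
Hypothesis infF : has_infima F.

Lemma dot_closure_dense (H : hilbertType theta) (M : set H) :
  (forall x, dot_closure (inner H) M x) -> dense M.
Proof.
move=> clM O [x Ox] openO.
have : nbhs x O by exact: open_nbhs_nbhs.
move=> /nbhs_ballP[e /= e0 xO]; have [y My xy] := clM x _ (exprn_gt0 2 e0).
exists y; split => //; apply: xO; rewrite -ball_normE /= distrC.
by rewrite -(ltr_pXn2r (n := 2))// ?nnegrE ?(ltW e0)// -inner_norm.
Qed.

(** Density: a vector [f + S f] orthogonal to the domain, paired with [f], forces [f = 0].
    Self-adjointness: if the adjoint sends [g] to [h], solve [f + S f = g + h]; then [g - f] is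
    orthogonal to the range of I + S, hence zero. *)
Lemma positive_onto_self_adjoint (H : hilbertType theta) (S : operator H H) :
  positive_operator S ->
  (forall h, exists2 f, op_dom S f & f + S f = h) -> self_adjoint S.
Proof.
move=> [Ssym Spos] Sonto.
have denseS : densely_defined S.
  apply: dot_closure_dense => y.
  have [p Sp yp] := orthogonal_projection y infF (@hilbert_complete _ _ H)
    (op_dom_linear S).
  suff /eqP : y - p = 0 by rewrite subr_eq0 => /eqP->.
  have [f Sf fy] := Sonto (y - p).
  have := yp f Sf; rewrite -fy linearDl/= => /eqP.
  rewrite paddr_eq0 ?dot_ge0 ?Spos// => /andP[/eqP/dot_eq0 -> _].
  by rewrite op_fun0 addr0.
exists denseS.
have adjS g : op_dom S g -> adjoint_rel S g (S g) by move=> Sg f Sf; exact: Ssym.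
have extS : extends (adjoint denseS) S.
  split=> g Sg; first by exists (S g); exact: adjS.
  apply: (adjoint_rel_inj denseS (g := g)); last exact: adjS.
  by apply: adjoint_funP; exists (S g); exact: adjS.
split=> //; have domS g : op_dom (adjoint denseS) g -> op_dom S g.
  move=> [h gh]; have [f Sf fgh] := Sonto (g + h).
  suff -> : g = f by [].
  apply/eqP; rewrite -subr_eq0; apply/eqP/(dot_eq0 (b := inner H)).
  have [u Su ugf] := Sonto (g - f).
  rewrite -{1}ugf linearDl/= !linearBr/= (Ssym u f Su Sf) (gh u Su) addrACA -opprD.
  by rewrite -!linearDr/= fgh subrr.
by split=> // g /domS Sg; rewrite (extS.2 g Sg).
Qed.

Lemma adjoint_comp_extension (H K : hilbertType theta) (T : operator H K)
    (denseT : densely_defined T) :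
  exists S : operator H H, positive_operator S /\ self_adjoint S /\
    extends S (op_comp (adjoint denseT) T).
Proof.
set A := op_comp _ T; pose bH := inner H; pose bK := inner K.
pose bHK := product_dot bH bK.
have AT f g : op_dom A f -> op_dom T g -> '[A f, g] = '[T f, T g].
  move=> [_ ATf] Tg; rewrite dotC [RHS]dotC; congr (theta _); apply: esym.
  exact: (adjoint_funP ATf).
have dT f : op_dom A f -> op_dom T f by case.
(* The graph of the adjoint of [T f |-> A f], taken in the closure of the range
   of T on op_dom A; that closure is described as a double orthogonal. *)
pose G : set (H * K) := [set p |
  (forall f, op_dom A f -> '[A f, p.1] = '[T f, p.2]) /\
  (forall k, (forall f, op_dom A f -> '[T f, k] = 0) -> '[p.2, k] = 0)].
have Gl : linear_set G.
  split; first by split=> [f _|k _] /=; rewrite ?linear0r ?linear0l.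
  move=> a p q [p1 p2] [q1 q2]; split=> [f Af|k Tk] /=.
    by rewrite !linearDr/= !dotZr p1// q1.
  by rewrite linearDl/= dotZl p2// q2// mulr0 addr0.
(* [g - g'] is orthogonal to the range of [T] on [op_dom A], hence, by the second clause of [G], to
   [g] and [g'] themselves. *)
have Gfun f g g' : G (f, g) -> G (f, g') -> g = g'.
  move=> [/= fg gE] [/= fg' g'E]; apply/eqP; rewrite -subr_eq0; apply/eqP.
  have Tgg' u : op_dom A u -> '[T u, g - g'] = 0.
    by move=> Au; rewrite linearBr/= -fg// -fg'// subrr.
  by apply: (dot_eq0 (b := bK)); rewrite linearBl/= gE// g'E// subrr.
(* [G] is an orthogonal complement: its clauses say that [p] is orthogonal to each [(A f, - T f)]
   and to each [(0, k)]. *)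
have Gclosed p : dot_closure bHK G p -> G p.
  move=> Gp; split=> [f Af|k Tk].
    have /(_ _ Gp) := @dot_closure_orthogonal _ _ _ bHK G p (A f, - T f).
    rewrite product_dotE/= linearNr/= => pf.
    rewrite dotC [RHS]dotC; congr (theta _); apply/eqP; rewrite -subr_eq0.
    apply/eqP/pf => q [qA _]; rewrite product_dotE/= linearNr/=.
    by rewrite dotC qA// -dotC subrr.
  have /(_ _ Gp) := @dot_closure_orthogonal _ _ _ bHK G p (0, k).
  rewrite product_dotE/= linear0r add0r; apply => q [_ qT].
  by rewrite product_dotE/= linear0r add0r; exact: qT.
(* The witness is the projection of [T f] onto the closure of the range of [T] on [op_dom A]. *)
have GT f : op_dom T f -> exists g, G (f, g).
  move=> Tf; pose N : set K := [set T u | u in op_dom A].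
  have Nl : linear_set N.
    split; first by exists 0; [exact: op_dom0|exact: op_fun0].
    move=> a _ _ [u Au <-] [v Av <-]; exists (a *: u + v); first exact: op_domP.
    by rewrite op_linear//; exact: dT.
  have [g Ng gT] := orthogonal_projection (T f) infF (@hilbert_complete _ _ K) Nl.
  exists g; split=> [u Au|k Tk] /=.
    rewrite AT//; apply/eqP; rewrite -subr_eq0 -linearBr/= dotC gT ?rmorph0//.
    by exists u.
  by apply: (dot_closure_orthogonal _ Ng) => _ [u Au <-]; exact: Tk.
(* The graph of L^* L: [g] is L f and [k] is L^* g. *)
pose r f k := exists2 g, G (f, g) & forall p, G p -> '[p.1, k] = '[p.2, g].
have [|||S rS] := @operator_of_rel F H H r.
- by exists 0; [exact: Gl.1|move=> p _; rewrite !linear0r].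
- move=> a f f' k k' [g fg gk] [g' fg' gk'].
  exists (a *: g + g'); first exact: (Gl.2 a (f, g) (f', g')).
  by move=> p Gp; rewrite !linearDr/= !dotZr gk// gk'.
- move=> f k k' [g fg gk] [g' fg' gk']; apply/eqP; rewrite -subr_eq0; apply/eqP.
  (* By [GT] the domain of L contains the dense domain of [T], so [k] is determined by [g]. *)
  apply: (dense_orthogonal_eq0 denseT) => u /GT[v uv].
  rewrite linearBr/= (gk _ uv) (gk' _ uv) /= (Gfun _ _ _ fg fg').
  by rewrite subrr.
have Spos : positive_operator S.
  split=> [f f' Sf Sf'|f Sf].
    have [g fg gk] := (rS f (S f)).2 (conj Sf erefl).
    have [g' fg' gk'] := (rS f' (S f')).2 (conj Sf' erefl).
    by rewrite dotC (gk _ fg') (gk' _ fg) -dotC.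
  have [g fg gk] := (rS f (S f)).2 (conj Sf erefl).
  by rewrite dotC (gk _ fg) /= -dotC dot_ge0.
exists S; split=> //; split.
  apply: positive_onto_self_adjoint => // h.
  (* Orthogonality of [(h - f, - g)] to [G] says exactly that L^* g = h - f, with g = L f. *)
  have [[f g] /Gclosed fg hfg] := orthogonal_projection (h, 0) infF
    (product_dot_complete (@hilbert_complete _ _ H) (@hilbert_complete _ _ K)) Gl.
  have [Sf Sfh] : op_dom S f /\ S f = h - f.
    apply/rS; exists g => // p Gp; have := hfg p Gp.
    rewrite product_dotE/= sub0r linearNl/= => /eqP.
    by rewrite subr_eq0 => /eqP hp; rewrite dotC hp -dotC.
  by exists f => //; rewrite Sfh addrC subrK.
have SA f : op_dom A f -> op_dom S f /\ S f = A f.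
  move=> Af; apply/rS; exists (T f).
    split=> [u Au|k Tk] /=; last exact: Tk.
    by rewrite AT//; exact: dT.
  by move=> p [Gp _]; rewrite dotC Gp// -dotC.
by split=> f /SA[].
Qed.

End SelfAdjointExtension.

Theorem theorem6p1 (R : realType) :
  (forall (H K : realHilbertType R) (T : operator H K)
          (denseT : densely_defined T),
     exists S : operator H H,
       positive_operator S /\ self_adjoint S /\
       extends S (op_comp (adjoint denseT) T))
  /\
  (forall (H K : complexHilbertType R) (T : operator H K)
          (denseT : densely_defined T),
     exists S : operator H H,
       positive_operator S /\ self_adjoint S /\
       extends S (op_comp (adjoint denseT) T)).
Proof.
split=> H K T denseT; apply: adjoint_comp_extension.
  exact: real_has_infima.
exact: complex_has_infima.
Qed.
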